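(* Let $\underline{q}=(q_1,\dots,q_N)$ be a probability vector and let $\mathbf{w}\in\{1,\dots,N\}^{\mathbb{N}}$ be a $\underline{q}$-frequency regular sequence. Let $(f_{j,i})_{1\le j\le N,\,1\le i\le K}$ be real numbers and, for $\alpha\in\mathbb{R}$, let $$E_{\mathbf{w}}(\alpha)=\Big\{\mathbf{i}\in\{1,\dots,K\}^{\mathbb{N}}:\lim_{n\to\infty}\frac1n\sum_{k=0}^{n-1}f_{w_k,i_k}=\alpha\Big\}.$$ Then for every $\alpha\in\mathbb{R}$, $$\begin{aligned}h_{\rm top}(E_{\mathbf{w}}(\alpha))&=\sup_{(p_{j,i})\in\mathcal{B}_{\underline{q}}(\Gamma)}\Big\{-\sum_{i,j}p_{j,i}\log p_{j,i}:\sum_{i,j}p_{j,i}f_{j,i}=\alpha\Big\}+\sum_{i=1}^Nq_i\log q_i\\&=\inf_{p\in\mathbb{R}}\big\{P_{\underline{q}}(p\cdot f)-p\alpha\big\}.\end{aligned}$$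
   Context: $\mathbb{N}=\{0,1,2,\dots\}$ and $\Sigma=\{1,\dots,K\}^{\mathbb{N}}$. A sequence $\mathbf{w}=(w_0,w_1,\dots)\in\{1,\dots,N\}^{\mathbb{N}}$ is $\underline{q}$-frequency regular if $\lim_{n\to\infty}\frac1n\#\{k\in[0,n]\cap\mathbb{Z}:w_k=i\}=q_i$ for every $i=1,\dots,N$. $\mathcal{B}_{\underline{q}}(\Gamma)$ is the set of probability vectors $(p_{j,i})_{j=1,i=1}^{N,K}$ (identified with Bernoulli measures on $(\{1,\dots,N\}\times\{1,\dots,K\})^{\mathbb{N}}$) such that $\sum_{i=1}^Kp_{j,i}=q_j$ for every $j$. $P_{\underline{q}}(p\cdot f)=\sum_{j=1}^Nq_j\log\sum_{i=1}^Ke^{p f_{j,i}}$. Topological entropy of $E\subseteq\Sigma$: the level $l(C)$ of a cylinder $C$ is the length of its defining word; $\mathcal{H}^s_r(E)=\inf\sum_{C}e^{-s\,l(C)}$ over covers of $E$ by cylinders of level larger than $r$; $\mathcal{H}^s(E)=\lim_{r\to\infty}\mathcal{H}^s_r(E)$; $h_{\rm top}(E)=\inf\{s\ge0:\mathcal{H}^s(E)<\infty\}$ for $E\ne\emptyset$. Conventions: $h_{\rm top}(\emptyset)=-\infty$, $\sup\emptyset=-\infty$, $0\log0=0$. *)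

(* Defs.v *)
From HB Require Import structures.
From mathcomp Require Import all_boot all_order all_algebra.
From mathcomp Require Import all_classical all_reals all_analysis.
Set Implicit Arguments.
Unset Strict Implicit.
Unset Printing Implicit Defensive.
Import Order.TTheory GRing.Theory Num.Theory.
Import numFieldNormedType.Exports.
Local Open Scope classical_set_scope.
Local Open Scope ring_scope.

(* The alphabets {1, ..., N} and {1, ..., K} are 'I_N and 'I_K. *)

Definition probability_vector (R : realType) (T : finType) (p : T -> R) : Prop :=
  (forall t, 0 <= p t) /\ \sum_t p t = 1.

(* k : 'I_n.+1 ranges over [0, n], so n + 1 indices are counted and the count
   is divided by n; the junk value at n = 0 does not affect the limit. *)
Definition frequency_regular (R : realType) (N : nat) (q : 'I_N -> R)
    (w : nat -> 'I_N) : Prop :=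
  forall i : 'I_N,
    (fun n : nat => n%:R^-1 * #|[set k : 'I_n.+1 | w k == i]%SET|%:R)
      @ \oo --> q i.

Definition bernoulli_vectors (R : realType) (N K : nat) (q : 'I_N -> R) :
    set ('I_N * 'I_K -> R) :=
  [set p | probability_vector p /\ forall j, \sum_(i < K) p (j, i) = q j].

Arguments bernoulli_vectors {R N} K q.

(* MathComp-Analysis sets ln 0 = 0, so 0 * ln 0 = 0 as required. *)
Definition shannon_entropy (R : realType) (T : finType) (p : T -> R) : R :=
  - \sum_t p t * ln (p t).

(* P_q(g); the pressure P_q(p . f) is [pressure q (fun j i => p * f j i)]. *)
Definition pressure (R : realType) (N K : nat) (q : 'I_N -> R)
    (g : 'I_N -> 'I_K -> R) : R :=
  \sum_(j < N) q j * ln (\sum_(i < K) expR (g j i)).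

Definition cylinder (K : nat) (u : seq 'I_K) : set (nat -> 'I_K) :=
  [set x : nat -> 'I_K | mkseq x (size u) = u].

(* A family of cylinders is given by the set of its defining words; the level
   of a cylinder is the length of its word. *)
Definition cylinder_cover (K : nat) (E : set (nat -> 'I_K)) (r : nat)
    (C : set (seq 'I_K)) : Prop :=
  (forall u, C u -> (r < size u)%N) /\ E `<=` \bigcup_(u in C) cylinder u.

Definition entropy_premeasure (R : realType) (K : nat) (s : R) (r : nat)
    (E : set (nat -> 'I_K)) : \bar R :=
  ereal_inf [set \esum_(u in C) (expR (- (s * (size u)%:R)))%:E
            | C in [set C | cylinder_cover E r C]].

Definition entropy_measure (R : realType) (K : nat) (s : R)
    (E : set (nat -> 'I_K)) : \bar R :=
  limn (fun r => entropy_premeasure s r E).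

Definition htop (R : realType) (K : nat) (E : set (nat -> 'I_K)) : \bar R :=
  if `[< E = set0 >] then -oo%E
  else ereal_inf [set s%:E
                 | s in [set s : R | 0 <= s /\ (entropy_measure s E < +oo)%E]].

Arguments htop R {K} E.

Definition level_set (R : realType) (N K : nat) (w : nat -> 'I_N)
    (f : 'I_N -> 'I_K -> R) (alpha : R) : set (nat -> 'I_K) :=
  [set x : nat -> 'I_K | (fun n : nat => n%:R^-1 * \sum_(k < n) f (w k) (x k))
             @ \oo --> alpha].

(* Main.v *)
(* Write S for the entropy supremum (plus sum of q ln q), h for the topological
   entropy and I for the infimum of the pressure; then S <= h <= I <= S.

   h <= I: for every t, cover the level set by all long words whose Birkhoff sum
   is within e of alpha on average, and bound their number by the exponential
   moment at t, which factors into partition functions.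

   S <= h: given p, let the k-th letter be drawn independently with the
   conditional law of p given w k. Chernoff bounds show that outside words of
   total weight at most 1/2 the averages of f and of the information -ln are
   n^(-1/4)-close to their means. The remaining points lie in the level set, and
   their cylinders have weight at most exp (- s n) for s below the entropy of p.
   Since a cover of the whole shift by cylinders has total weight at least 1
   (Koenig's lemma reduces this to words of a single length, so no measure is
   needed), every cover of the level set has sum at least 1/2.

   I <= S: Gibbs vectors solving a slightly perturbed mean equation have entropy
   at least I and mean close to alpha; conclude by compactness of the simplex. *)
Require Import Defs.
From mathcomp Require Import all_boot all_order all_algebra.
From mathcomp Require Import all_classical all_reals all_analysis.
From mathcomp Require Import ring lra.
Import Order.TTheory GRing.Theory Num.Theory.
Import numFieldNormedType.Exports.
Local Open Scope classical_set_scope.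
Local Open Scope ring_scope.
Set Implicit Arguments.
Unset Strict Implicit.
Unset Printing Implicit Defensive.

(** * Words *)

Fixpoint words (K n : nat) : seq (seq 'I_K) :=
  if n is m.+1 then [seq rcons u i | u <- words K m, i <- enum 'I_K]
  else [:: [::]].

Lemma mem_words (K n : nat) (u : seq 'I_K) : (u \in words K n) = (size u == n).
Proof.
elim: n u => [|n IH] u /=; first by rewrite inE size_eq0.
apply/allpairsP/eqP => [[[v i]] /= [+ _ ->]|].
  by rewrite IH size_rcons => /eqP ->.
case/lastP: u => [//|u i]; rewrite size_rcons => -[su].
by exists (u, i); rewrite IH su mem_enum.
Qed.

Lemma uniq_words (K n : nat) : uniq (words K n).
Proof.
elim: n => //= n IH; apply: allpairs_uniq => //; first exact: enum_uniq.
by move=> [u i] [v j] _ _ /= /rcons_inj[-> ->].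
Qed.

Lemma sum_wordsS {R : realType} (K n : nat) (F : seq 'I_K -> R) :
  \sum_(u <- words K n.+1) F u =
  \sum_(u <- words K n) \sum_(i < K) F (rcons u i).
Proof. by rewrite /= big_allpairs_dep; apply: eq_bigr => u _; rewrite big_enum. Qed.

(** Letters carry their index because the functions and laws summed along a word vary with time
    through [w]. *)
Definition positioned {K : nat} (u : seq 'I_K) : seq (nat * 'I_K) :=
  zip (iota 0 (size u)) u.

Lemma positioned_rcons (K : nat) (u : seq 'I_K) (i : 'I_K) :
  positioned (rcons u i) = rcons (positioned u) (size u, i).
Proof.
rewrite /positioned size_rcons -addn1 iotaD add0n cats1 zip_rcons //.
by rewrite size_iota.
Qed.

Definition birkhoff {R : realType} {K : nat} (g : nat -> 'I_K -> R)
    (u : seq 'I_K) : R :=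
  \sum_(p <- positioned u) g p.1 p.2.

(** When every [P k] is a probability vector, this is the mass of the cylinder of [u] under the
    product measure with marginals [P k]. *)
Definition weight {R : realType} {K : nat} (P : nat -> 'I_K -> R)
    (u : seq 'I_K) : R :=
  \prod_(p <- positioned u) P p.1 p.2.

Lemma birkhoff_rcons {R : realType} (K : nat) (g : nat -> 'I_K -> R) u i :
  birkhoff g (rcons u i) = birkhoff g u + g (size u) i.
Proof. by rewrite /birkhoff positioned_rcons -cats1 big_cat big_seq1. Qed.

Lemma weight_rcons {R : realType} (K : nat) (P : nat -> 'I_K -> R) u i :
  weight P (rcons u i) = weight P u * P (size u) i.
Proof. by rewrite /weight positioned_rcons -cats1 big_cat big_seq1. Qed.

Lemma birkhoff_mkseq {R : realType} (K : nat) (g : nat -> 'I_K -> R) x n :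
  birkhoff g (mkseq x n) = \sum_(k < n) g k (x k).
Proof.
elim: n => [|n IH]; first by rewrite /birkhoff /positioned big_nil big_ord0.
by rewrite mkseqS birkhoff_rcons IH big_ord_recr size_mkseq.
Qed.

Lemma weight_ge0 {R : realType} (K : nat) (P : nat -> 'I_K -> R) u :
  (forall k i, 0 <= P k i) -> 0 <= weight P u.
Proof. by move=> P0; apply: prodr_ge0 => p _; exact: P0. Qed.

Lemma sum_weight {R : realType} (K n : nat) (P : nat -> 'I_K -> R) :
  \sum_(u <- words K n) weight P u = \prod_(k < n) \sum_(i < K) P k i.
Proof.
elim: n => [|n IH]; first by rewrite big_seq1 big_ord0 /weight /positioned big_nil.
rewrite sum_wordsS big_ord_recr /= -IH mulr_suml big_seq [RHS]big_seq.
apply: eq_bigr => u; rewrite mem_words => /eqP su.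
by rewrite mulr_sumr; apply: eq_bigr => i _; rewrite weight_rcons su.
Qed.

Lemma weight_expR {R : realType} (K : nat) (g : nat -> 'I_K -> R) u :
  weight (fun k i => expR (g k i)) u = expR (birkhoff g u).
Proof. by rewrite /weight /birkhoff expR_sum. Qed.

Lemma weightM {R : realType} (K : nat) (P Q : nat -> 'I_K -> R) u :
  weight (fun k i => P k i * Q k i) u = weight P u * weight Q u.
Proof. by rewrite /weight big_split. Qed.

Lemma birkhoffZ {R : realType} (K : nat) (c : R) (g : nat -> 'I_K -> R) u :
  birkhoff (fun k i => c * g k i) u = c * birkhoff g u.
Proof. by rewrite /birkhoff mulr_sumr. Qed.

Lemma birkhoffB {R : realType} (K : nat) (g : nat -> 'I_K -> R) (m : nat -> R) u :
  birkhoff (fun k i => g k i - m k) u = birkhoff g u - \sum_(k < size u) m k.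
Proof.
elim/last_ind: u => [|u i IH]; first by rewrite /birkhoff /positioned !big_nil big_ord0 subr0.
by rewrite !birkhoff_rcons IH size_rcons big_ord_recr /=; ring.
Qed.

(** Consistency of the product measure: the letters after position [m] are summed out one at a time,
    each contributing a factor 1. *)
Lemma sum_weight_take {R : realType} (K m n : nat) (P : nat -> 'I_K -> R)
    (G : seq 'I_K -> R) :
  (forall k, \sum_(i < K) P k i = 1) -> (m <= n)%N ->
  \sum_(u <- words K n) weight P u * G (take m u) =
  \sum_(u <- words K m) weight P u * G u.
Proof.
move=> P1; elim: n => [|n IH]; first by rewrite leqn0 => /eqP ->; rewrite !big_seq1.
rewrite leq_eqVlt => /predU1P[->|]; last rewrite ltnS => mn.
  rewrite big_seq [RHS]big_seq; apply: eq_bigr => u.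
  by rewrite mem_words => /eqP su; rewrite -{1}su take_size.
rewrite -(IH mn) sum_wordsS big_seq [RHS]big_seq; apply: eq_bigr => u.
rewrite mem_words => /eqP su.
transitivity (\sum_(i < K) weight P u * G (take m u) * P n i).
  apply: eq_bigr => i _; rewrite weight_rcons su -cats1 takel_cat ?su//; ring.
by rewrite -mulr_sumr P1 mulr1.
Qed.

(** In the tree of words having no prefix in [D], the node [u] has descendants of every depth. *)
Definition avoidable_after {K : nat} (D : set (seq 'I_K)) (u : seq 'I_K) : Prop :=
  forall n, exists v : seq 'I_K, size v = n /\
    forall m, (m <= size u + n)%N -> ~ D (take m (u ++ v)).

Lemma avoidable_after_rcons (K : nat) (D : set (seq 'I_K)) (u : seq 'I_K) :
  avoidable_after D u -> exists i, avoidable_after D (rcons u i).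
Proof.
move=> au; apply: contrapT => /forallNP H.
have {}H : forall i : 'I_K, exists n, forall v : seq 'I_K, size v = n ->
    exists m, (m <= (size u).+1 + n)%N /\ D (take m (rcons u i ++ v)).
  move=> i; have /existsNP[n /forallNP Hn] := H i; exists n => v sv.
  apply: contrapT => /forallNP Hv; apply: (Hn v); split=> // m mn Dm.
  by apply: (Hv m); split=> //; move: mn; rewrite size_rcons.
have [N HN] := choice H.
(* [N i] is a depth at which the child [i] has no surviving descendant. The extra 1 pays for the
   letter [i] itself, so at least [N i] letters remain after it. *)
have [[|i v] [sv Hv]] := au (\max_i N i).+1; first by [].
have Ni : (N i <= size v)%N by move: sv => [->]; exact: leq_bigmax.
have [m [mn Dm]] := HN i (take (N i) v) (size_takel Ni).
apply: (Hv m).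
  by rewrite (leq_trans mn)// addSnnS leq_add2l ltnS leq_bigmax.
move: Dm; rewrite cat_rcons; congr (D _).
rewrite !take_cat; case: ltnP => // um; congr (_ ++ _).
case: (m - size u)%N (leq_sub2r (size u) mn) => //= k.
rewrite addSnnS addKn ltnS => kN; congr (_ :: _).
by rewrite take_takel.
Qed.

(* Koenig's lemma, that is, compactness of the full shift. *)
Lemma uniform_prefix (K : nat) (D : set (seq 'I_K)) :
  (forall x : nat -> 'I_K, exists n, D (mkseq x n)) ->
  exists n, forall u : seq 'I_K, size u = n ->
    exists m, (m <= n)%N /\ D (take m u).
Proof.
move=> HD; apply: contrapT => /forallNP H.
have a0 : avoidable_after D [::].
  move=> n; have /existsNP[v Hv] := H n.
  exists v; split=> [|m mn Dm]; first by apply: contrapT => sv; apply: Hv => /sv.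
  by apply: Hv => sv; exists m.
(* A surviving word of length 1 supplies the letter [i0], the default value of the choice function
   at dead ends. *)
have [[|i0 v0] [//= _ _]] := a0 1%N.
have /choice[F HF] : forall u, exists i,
    avoidable_after D u -> avoidable_after D (rcons u i).
  move=> u; have [/avoidable_after_rcons[i ai]|nau] := pselect (avoidable_after D u).
    by exists i.
  by exists i0 => /nau.
(* The [U n] are the prefixes of one infinite branch; each is avoidable, hence outside [D], against
   the hypothesis on that point. *)
pose U n := iter n (fun u => rcons u (F u)) [::].
have Ux n : mkseq (fun k => F (U k)) n = U n by elim: n => // n IH; rewrite mkseqS IH.
have [n] := HD (fun k => F (U k)); rewrite Ux.
have /(_ 0%N)[v [/size0nil -> /(_ (size (U n)))]] : avoidable_after D (U n).
  by elim: n => // n IH; exact: HF.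
by rewrite cats0 take_size addn0; apply.
Qed.

(** By [uniform_prefix] all words of some length [n] have a prefix in [D]. Rewritten as a sum over
    words of length [n], the double sum counts each weight at least once, and these weights add up
    to 1. *)
Lemma prefix_weight_ge1 {R : realType} (K : nat) (P : nat -> 'I_K -> R)
    (D : set (seq 'I_K)) :
  (forall k i, 0 <= P k i) -> (forall k, \sum_(i < K) P k i = 1) ->
  (forall x : nat -> 'I_K, exists n, D (mkseq x n)) ->
  exists n, 1 <= \sum_(m < n) \sum_(u <- words K m | `[< D u >]) weight P u.
Proof.
move=> P0 P1 /uniform_prefix[n Hn]; exists n.+1.
have <- : \sum_(u <- words K n) weight P u = 1.
  by rewrite sum_weight big1 // => k _.
have E (m : 'I_n.+1) : \sum_(u <- words K m | `[< D u >]) weight P u =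
    \sum_(u <- words K n) weight P u * (`[< D (take m u) >] : nat)%:R.
  rewrite (@sum_weight_take _ _ m n P (fun u => (`[< D u >] : nat)%:R)) //; last first.
    by rewrite -ltnS.
  by rewrite big_mkcond; apply: eq_bigr => u _; case: asboolP; rewrite ?(mulr1, mulr0).
rewrite (eq_bigr _ (fun m _ => E m)) exchange_big big_seq [leRHS]big_seq /=.
apply: ler_sum => u; rewrite mem_words => /eqP /Hn[m [mn Dm]].
rewrite -mulr_sumr ler_peMr ?weight_ge0//.
rewrite (bigD1 (Ordinal (mn : (m < n.+1)%N)))//= asboolT// lerDl.
by apply: sumr_ge0 => j _; rewrite ler0n.
Qed.

(** * Sums over families of words, truncated by length *)

Fixpoint words_below (K n : nat) : seq (seq 'I_K) :=
  if n is m.+1 then words_below K m ++ words K m else [::].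

Lemma mem_words_below (K n : nat) (u : seq 'I_K) :
  (u \in words_below K n) = (size u < n)%N.
Proof.
by elim: n => [|n IH] //=; rewrite mem_cat IH mem_words ltnS [RHS]leq_eqVlt orbC.
Qed.

Lemma uniq_words_below (K n : nat) : uniq (words_below K n).
Proof.
elim: n => [|n IH] //=; rewrite cat_uniq IH uniq_words andbT /=.
apply/hasPn => u; rewrite mem_words => /eqP su.
by rewrite /= mem_words_below su ltnn.
Qed.

Lemma sum_words_below {R : realType} (K n : nat) (p : pred (seq 'I_K))
    (a : seq 'I_K -> R) :
  \sum_(u <- words_below K n | p u) a u =
  \sum_(m < n) \sum_(u <- words K m | p u) a u.
Proof.
elim: n => [|n IH]; first by rewrite big_nil big_ord0.
by rewrite big_ord_recr /= big_cat IH.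
Qed.

Lemma esum_words_ge {R : realType} (K n : nat) (C : set (seq 'I_K))
    (a : seq 'I_K -> R) :
  ((\sum_(m < n) \sum_(u <- words K m | `[< C u >]) a u)%:E <=
  \esum_(u in C) (a u)%:E)%E.
Proof.
rewrite -sum_words_below -big_filter.
set X := [seq _ <- _ | _]; apply: esum_ge; exists [set` X]; last first.
  rewrite -fsbig_seq ?filter_uniq ?uniq_words_below//.
  by rewrite sumEFin.
split; first exact: finite_seq.
by move=> u /=; rewrite mem_filter => /andP[/asboolP].
Qed.

(** The unordered sum is a supremum over finite subfamilies, and the words of a finite subfamily
    have bounded length. *)
Lemma esum_words_le {R : realType} (K : nat) (C : set (seq 'I_K))
    (a : seq 'I_K -> R) (B : R) :
  (forall u, 0 <= a u) ->
  (forall n, \sum_(m < n) \sum_(u <- words K m | `[< C u >]) a u <= B) ->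
  (\esum_(u in C) (a u)%:E <= B%:E)%E.
Proof.
move=> a0 HB; apply: ge_ereal_sup => _ [X [/finite_seqP[s Xs] XC] <-].
move: XC; have {Xs}-> : X = [set` undup s].
  by rewrite Xs; apply/seteqP; split=> u /=; rewrite mem_undup.
move=> XC; pose n := (\max_(u <- s) size u).+1.
rewrite -fsbig_seq ?undup_uniq// sumEFin lee_fin.
apply: le_trans (HB n); rewrite -sum_words_below.
rewrite (perm_big [seq u <- words_below K n | u \in s]); last first.
  apply: uniq_perm; rewrite ?undup_uniq ?filter_uniq ?uniq_words_below// => u.
  rewrite mem_undup mem_filter mem_words_below; case us: (u \in s) => //=.
  by rewrite ltnS; apply/esym; exact: leq_bigmax_seq.
rewrite big_filter big_mkcond [leRHS]big_mkcond; apply: ler_sum => u _.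
case: ifP => us; case: asboolP => // nCu.
by case: nCu; apply: XC => /=; rewrite ?mem_undup.
Qed.

Lemma cvg_invn {R : realType} : (fun n : nat => n%:R^-1 : R) @ \oo --> (0 : R).
Proof. by rewrite -cvg_shiftS; exact: cvg_harmonic. Qed.

Lemma cvg_sumr {R : realType} (T : Type) (F : set_system T) {FF : Filter F}
    (I : Type) (r : seq I) (f : I -> T -> R) (a : I -> R) :
  (forall i, f i x @[x --> F] --> a i) ->
  (\sum_(i <- r) f i x) @[x --> F] --> \sum_(i <- r) a i.
Proof.
by move=> fa; apply: cvg_big => [x|i _]; [exact: add_continuous|exact: fa].
Qed.

(** * Gibbs vectors *)

Definition partition_function {R : realType} {K : nat} (g : 'I_K -> R) : R :=
  \sum_(i < K) expR (g i).

Lemma partition_function_gt0 {R : realType} (K : nat) (g : 'I_K -> R) :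
  (0 < K)%N -> 0 < partition_function g.
Proof.
case: K g => // K g _; rewrite /partition_function big_ord_recl ltr_wpDr ?expR_gt0//.
by apply: sumr_ge0 => i _; exact: expR_ge0.
Qed.

Lemma ln_le_subr1 {R : realType} (x : R) : 0 < x -> ln x <= x - 1.
Proof.
move=> x0; have -> : ln x = ln (1 + (x - 1)) by congr ln; ring.
by apply: le_ln1Dx; rewrite ltrBrDl subrr.
Qed.

(** Nonnegativity of the relative entropy of [p] with respect to the Gibbs vector of total mass [c]:
    apply [ln x <= x - 1] with x the ratio of their entries, and sum against [p]. *)
Lemma gibbs_inequality {R : realType} (K : nat) (hK : (0 < K)%N) (p g : 'I_K -> R)
    (c : R) :
  (forall i, 0 <= p i) -> \sum_i p i = c ->
  - (\sum_i p i * ln (p i)) + c * ln c + \sum_i p i * g i <=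
  c * ln (partition_function g).
Proof.
move=> p0 pc; set Z := partition_function g.
have Z0 : 0 < Z by exact: partition_function_gt0.
have c0 : 0 <= c by rewrite -pc; exact: sumr_ge0.
have H i : p i * (ln c + g i - ln Z - ln (p i)) <= c * expR (g i) / Z - p i.
  have := p0 i; rewrite le0r => /predU1P[->|pi0].
    by rewrite mul0r subr0 divr_ge0 ?mulr_ge0 ?expR_ge0 ?(ltW Z0).
  have cpos : 0 < c.
    rewrite -pc (lt_le_trans pi0)// (bigD1 i)//= lerDl.
    by apply: sumr_ge0 => j _; exact: p0.
  have e0 := expR_gt0 (g i).
  have : ln (c * expR (g i) / Z / p i) <= c * expR (g i) / Z / p i - 1.
    by apply: ln_le_subr1; rewrite !divr_gt0 ?mulr_gt0.
  rewrite !ln_div ?posrE ?divr_gt0 ?mulr_gt0// lnM ?posrE// expRK.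
  move=> /(ler_wpM2l (p0 i)) /le_trans; apply.
  rewrite mulrBr mulr1 [p i * _]mulrC divfK ?gt_eqF//.
have : \sum_i p i * (ln c + g i - ln Z - ln (p i)) <=
       \sum_i (c * expR (g i) / Z - p i) by apply: ler_sum => i _.
rewrite sumrB pc -mulr_suml -mulr_sumr -/Z -/(partition_function g) -/Z.
rewrite mulfK ?gt_eqF// subrr.
have -> : \sum_i p i * (ln c + g i - ln Z - ln (p i)) =
  c * ln c + \sum_i p i * g i - c * ln Z - \sum_i p i * ln (p i).
  rewrite -pc !mulr_suml -big_split -sumrB -sumrB /=.
  by apply: eq_bigr => i _; ring.
lra.
Qed.

Lemma shannon_entropy_pair {R : realType} (N K : nat) (p : 'I_N * 'I_K -> R) :
  shannon_entropy p = - \sum_j \sum_i p (j, i) * ln (p (j, i)).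
Proof.
by rewrite /shannon_entropy pair_big /=; congr (- _); apply: eq_bigr => -[].
Qed.

Lemma entropy_le_pressure {R : realType} (N K : nat) (hK : (0 < K)%N)
    (q : 'I_N -> R) (f : 'I_N -> 'I_K -> R) (p : 'I_N * 'I_K -> R) (t : R) :
  bernoulli_vectors K q p ->
  shannon_entropy p + \sum_j q j * ln (q j) <=
  pressure q (fun j i => t * f j i) - t * (\sum_j \sum_i p (j, i) * f j i).
Proof.
move=> [[p0 _] pq]; rewrite lerBrDr shannon_entropy_pair /pressure.
rewrite mulr_sumr -sumrN -!big_split /=; apply: ler_sum => j _.
have := gibbs_inequality hK (fun i => t * f j i) (fun i => p0 (j, i)) (pq j).
rewrite /partition_function mulr_sumr.
by under [X in _ + X <= _ -> _]eq_bigr do rewrite mulrCA.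
Qed.

(** The derivative in [t] of the logarithm of the partition function of [t * h]. *)
Definition gibbs_mean {R : realType} {K : nat} (h : 'I_K -> R) (t : R) : R :=
  (\sum_i h i * expR (t * h i)) / partition_function (fun i => t * h i).

Lemma continuous_gibbs_mean {R : realType} (K : nat) (hK : (0 < K)%N)
    (h : 'I_K -> R) : continuous (gibbs_mean h).
Proof.
have ce i : continuous (fun t : R => expR (t * h i)).
  move=> t; apply: (@continuous_comp _ _ _ (fun t : R => t * h i) expR).
    by apply: mulrr_continuous.
  exact: continuous_expR.
have cZ (t : R) : partition_function (fun i => t' * h i) @[t' --> t] -->
    partition_function (fun i => t * h i) by apply: cvg_sumr => i; exact: ce.
move=> t; apply: cvgM; first by apply: cvg_sumr => i; apply: cvgMl_tmp; exact: ce.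
apply: cvgV; last exact: cZ.
by rewrite gt_eqF ?partition_function_gt0.
Qed.

Lemma gibbs_mean_le {R : realType} (K : nat) (hK : (0 < K)%N)
    (h : 'I_K -> R) (c t : R) : (forall i, `|h i| <= c) -> `|gibbs_mean h t| <= c.
Proof.
move=> hc; rewrite /gibbs_mean normrM normfV.
have Z0 := partition_function_gt0 (fun i => t * h i) hK.
rewrite (gtr0_norm Z0) ler_pdivrMr// mulr_sumr (le_trans (ler_norm_sum _ _ _))//.
apply: ler_sum => i _; rewrite normrM (gtr0_norm (expR_gt0 _)).
by rewrite ler_pM2r ?expR_gt0.
Qed.

Definition gibbs_vector {R : realType} {N K : nat} (q : 'I_N -> R)
    (f : 'I_N -> 'I_K -> R) (t : R) (x : 'I_N * 'I_K) : R :=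
  q x.1 * (expR (t * f x.1 x.2) / partition_function (fun i => t * f x.1 i)).

Lemma gibbs_vector_bernoulli {R : realType} (N K : nat) (hK : (0 < K)%N)
    (q : 'I_N -> R) (f : 'I_N -> 'I_K -> R) (t : R) :
  probability_vector q -> bernoulli_vectors K q (gibbs_vector q f t).
Proof.
move=> [q0 q1].
have Hq j : \sum_i gibbs_vector q f t (j, i) = q j.
  rewrite /gibbs_vector /= -mulr_sumr -mulr_suml divff ?mulr1//.
  by rewrite gt_eqF// partition_function_gt0.
split=> //; split=> [[j i]|].
  by rewrite mulr_ge0// divr_ge0 ?expR_ge0// ltW// partition_function_gt0.
rewrite -q1 -(eq_bigr _ (fun j _ => Hq j)) pair_big /=.
by apply: eq_bigr => -[].
Qed.

Lemma gibbs_vector_mean {R : realType} (N K : nat)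
    (q : 'I_N -> R) (f : 'I_N -> 'I_K -> R) (t : R) :
  \sum_j \sum_i gibbs_vector q f t (j, i) * f j i =
  \sum_j q j * gibbs_mean (f j) t.
Proof.
apply: eq_bigr => j _; rewrite /gibbs_mean mulr_suml mulr_sumr.
by apply: eq_bigr => i _; rewrite /gibbs_vector /=; ring.
Qed.

(** The equality case of [entropy_le_pressure]: the logarithm of a Gibbs entry is affine in [f j i].
    Rows with [q j = 0] vanish on both sides. *)
Lemma gibbs_vector_entropy {R : realType} (N K : nat) (hK : (0 < K)%N)
    (q : 'I_N -> R) (f : 'I_N -> 'I_K -> R) (t : R) :
  probability_vector q ->
  shannon_entropy (gibbs_vector q f t) + \sum_j q j * ln (q j) =
  pressure q (fun j i => t * f j i) - t * \sum_j q j * gibbs_mean (f j) t.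
Proof.
move=> hq; have [[p0 _] pq] := gibbs_vector_bernoulli hK f t hq.
have [q0 _] := hq.
rewrite -gibbs_vector_mean shannon_entropy_pair /pressure.
apply/eqP; rewrite eq_sym subr_eq mulr_sumr -sumrN -!big_split /=; apply/eqP.
apply: eq_bigr => j _; rewrite -/(partition_function _); set Z := partition_function _.
have Z0 : 0 < Z by exact: partition_function_gt0.
have := q0 j; rewrite le0r => /predU1P[qj|qj0].
  by rewrite qj !mul0r !big1 ?mulr0 ?oppr0 ?addr0// => i _; rewrite /gibbs_vector qj !mul0r.
have -> : \sum_i gibbs_vector q f t (j, i) * ln (gibbs_vector q f t (j, i)) =
  \sum_i (gibbs_vector q f t (j, i) * ln (q j)
     + (t * (gibbs_vector q f t (j, i) * f j i) - gibbs_vector q f t (j, i) * ln Z)).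
  apply: eq_bigr => i _; rewrite {2}/gibbs_vector /= -/Z.
  rewrite lnM ?posrE ?divr_gt0 ?expR_gt0// ln_div ?posrE ?expR_gt0// expRK.
  by ring.
by rewrite !(big_split, sumrN) -!mulr_suml -mulr_sumr pq /=; ring.
Qed.

(** * Attaining the pressure bound by a vector of mean [alpha] *)

Lemma continuous_xlnx {R : realType} : continuous (fun x : R => x * ln x).
Proof.
move=> x; have [x0|x0|->] := ltgtP x 0.
- apply: (@near_cst_continuous _ _ 0); near=> y.
  by rewrite ln0 ?mulr0// ltW//; near: y; exact: lt_nbhsl.
- by apply: cvgM; [exact: cvg_id|exact: continuous_ln].
apply/cvgrPdist_le => e e0; rewrite mul0r; near=> y.
rewrite sub0r normrN.
have [y0|y0] := leP y 0; first by rewrite ln0// mulr0 normr0 ltW.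
have y1 : y < 1 by near: y; apply: lt_nbhsl.
(* With [y = s * s], the bound [- ln s <= s^-1] gives [|y * ln y| <= 2 * s]. *)
pose s := Num.sqrt y.
have s0 : 0 < s by rewrite sqrtr_gt0.
have sy : s * s = y by rewrite -expr2 sqr_sqrtr// ltW.
have se : 2 * s <= e.
  rewrite -ler_pdivlMl// -(@ger0_norm _ (2^-1 * e)) ?mulr_ge0 ?ltW// -sqrtr_sqr.
  rewrite /s ltr_sqrt ?exprn_gt0 ?mulr_gt0//; near: y; apply: lt_nbhsl.
  by rewrite exprn_gt0// mulr_gt0.
have := ln_le_subr1 (_ : 0 < s^-1); rewrite invr_gt0 => /(_ s0).
rewrite lnV ?posrE// => H.
have ly : ln y = 2 * ln s by rewrite -sy lnM ?posrE//; ring.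
have ly0 : ln y <= 0 by rewrite ln_le0// ltW.
rewrite normrM gtr0_norm// ler0_norm// ly -sy.
apply: le_trans se.
have : s * s * (- ln s) <= s * s * s^-1.
  by rewrite ler_pM2l ?mulr_gt0//; apply: le_trans H _; rewrite gerBl.
by rewrite mulfK ?gt_eqF// -mulrN mulrCA ler_pM2l.
Unshelve. all: by end_near.
Qed.

(* The equation M t = alpha for the Gibbs mean M need not have a solution (alpha
   may be extremal or unattainable); M t + h * t = alpha always has one, and h * t
   is small when the pressure bound holds, since c + h * t ^+ 2 is then at most
   the pressure at 0. *)
Lemma near_mean_gibbs_vector {R : realType} (N K : nat) (hK : (0 < K)%N)
    (q : 'I_N -> R) (f : 'I_N -> 'I_K -> R) (alpha c e : R) :
  probability_vector q -> 0 < e ->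
  (forall t, c <= pressure q (fun j i => t * f j i) - t * alpha) ->
  exists p : 'I_N * 'I_K -> R, [/\ bernoulli_vectors K q p,
    `|\sum_j \sum_i p (j, i) * f j i - alpha| <= e &
    c <= shannon_entropy p + \sum_j q j * ln (q j)].
Proof.
move=> hq e0 Hc; have [q0 q1] := hq.
pose M t := \sum_j q j * gibbs_mean (f j) t.
pose P t := pressure q (fun j i => t * f j i).
pose b := \sum_j \sum_i `|f j i|.
have fb j i : `|f j i| <= b.
  rewrite /b (bigD1 j)//= (bigD1 i)//= -addrA lerDl addr_ge0//.
    by apply: sumr_ge0.
  by apply: sumr_ge0 => ? _; apply: sumr_ge0.
have Mb t : `|M t| <= b.
  rewrite (le_trans (ler_norm_sum _ _ _))// -[leRHS]mul1r -q1 mulr_suml.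
  apply: ler_sum => j _; rewrite normrM ger0_norm// ler_wpM2l//.
  exact: gibbs_mean_le.
pose D := P 0 - c.
have D0 : 0 <= D by rewrite subr_ge0; have := Hc 0; rewrite mul0r subr0.
(* Chosen so that [h * t ^+ 2 <= D] forces [(h * t) ^+ 2 <= h * D <= e ^+ 2]. *)
pose h := e ^+ 2 / (D + 1).
have h0 : 0 < h by rewrite divr_gt0 ?exprn_gt0// ltr_wpDl.
have [t Mt] : exists t, M t + h * t = alpha.
  have cM : continuous (fun t => M t + h * t).
    move=> t; apply: cvgD; last by apply: cvgMl_tmp; exact: cvg_id.
    by apply: cvg_sumr => j; apply: cvgMl_tmp; exact: continuous_gibbs_mean.
  (* At [T] and [- T] the linear term outweighs [M], which is bounded by [b], so the two values
     enclose [alpha]. *)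
  pose T := (b + `|alpha|) / h.
  have b0 : 0 <= b by exact: le_trans (normr_ge0 _) (Mb 0).
  have T0 : 0 <= T by rewrite divr_ge0 ?addr_ge0// ltW.
  have hT : h * T = b + `|alpha| by rewrite mulrC divfK ?gt_eqF.
  have [|||t _ Ht] := @IVT R (fun t => M t + h * t) (- T) T alpha.
  - by rewrite (le_trans _ T0)// oppr_le0.
  - by apply: continuous_subspaceT => x; exact: cM.
  - rewrite mulrN hT ge_min le_max; have := Mb T; have := Mb (- T).
    rewrite !ler_norml => /andP[_ H1] /andP[H2 _].
    have /andP[H3 H4] : - `|alpha| <= alpha <= `|alpha| by rewrite -ler_norml.
    by apply/andP; split; apply/orP; [left|right]; lra.
  by exists t.
exists (gibbs_vector q f t); have Hb := gibbs_vector_bernoulli hK f t hq.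
have E : shannon_entropy (gibbs_vector q f t) + \sum_j q j * ln (q j) =
    P t - t * alpha + h * t ^+ 2.
  by rewrite gibbs_vector_entropy// -/(M t) -/(P t) -Mt; ring.
have ht2 : h * t ^+ 2 <= D.
  have := entropy_le_pressure hK f 0 Hb; rewrite mul0r subr0 -/(P 0) E.
  by have := Hc t; rewrite -/(P t) /D; lra.
split=> //.
  rewrite gibbs_vector_mean -/(M t) -Mt opprD addrA subrr sub0r normrN.
  rewrite -(@ler_pXn2r _ 2)// ?nnegrE ?(ltW e0)// -normrX ger0_norm ?sqr_ge0//.
  rewrite exprMn expr2 -mulrA.
  apply: (le_trans (ler_wpM2l (ltW h0) ht2)).
  rewrite /h -mulrA ler_piMr ?sqr_ge0// mulrC ler_pdivrMr ?mul1r ?ltr_wpDl//.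
  by rewrite lerDl.
rewrite E; have := Hc t; rewrite -/(P t).
have : 0 <= h * t ^+ 2 by rewrite mulr_ge0 ?sqr_ge0// ltW.
lra.
Qed.

Lemma continuous_sumr {R : realType} (T : topologicalType) (I : Type) (r : seq I)
    (f : I -> T -> R) :
  (forall i, continuous (f i)) -> continuous (fun x => \sum_(i <- r) f i x).
Proof. by move=> cf x; apply: cvg_sumr => i; exact: cf. Qed.

Lemma continuous_mean {R : realType} (T : topologicalType) (N K : nat)
    (f : 'I_N -> 'I_K -> R) (p : T -> 'I_N * 'I_K -> R) :
  (forall x, continuous (p ^~ x)) ->
  continuous (fun t => \sum_j \sum_i p t (j, i) * f j i).
Proof.
move=> cp; apply: continuous_sumr => j; apply: continuous_sumr => i t.
by apply: cvgMr_tmp; exact: cp.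
Qed.

Lemma continuous_shannon_entropy {R : realType} (T : topologicalType) (I : finType)
    (p : T -> I -> R) :
  (forall x, continuous (p ^~ x)) -> continuous (fun t => shannon_entropy (p t)).
Proof.
move=> cp t; apply: cvgN; apply: (continuous_sumr (f := fun x t => p t x * ln (p t x))).
move=> x {}t.
by apply: (cvg_comp (p ^~ x) (fun y : R => y * ln y) (cp x t)); exact: continuous_xlnx.
Qed.

Lemma bernoulli_vector_of_pressure {R : realType} (N K : nat) (hK : (0 < K)%N)
    (q : 'I_N -> R) (f : 'I_N -> 'I_K -> R) (alpha c : R) :
  probability_vector q ->
  (forall t, c <= pressure q (fun j i => t * f j i) - t * alpha) ->
  exists p : 'I_N * 'I_K -> R, [/\ bernoulli_vectors K q p,
    \sum_j \sum_i p (j, i) * f j i = alpha &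
    c <= shannon_entropy p + \sum_j q j * ln (q j)].
Proof.
move=> hq Hc; have [q0 q1] := hq.
pose T := prod_topology (fun _ : 'I_N * 'I_K => R).
have cproj x : continuous (fun p : T => p x).
  exact: (@proj_continuous _ (fun _ : 'I_N * 'I_K => R) x).
pose mean (p : T) := \sum_j \sum_i p (j, i) * f j i.
have cmean : continuous mean.
  exact: (@continuous_mean R T N K f id cproj).
have cent : continuous (fun p : T => shannon_entropy p).
  exact: (@continuous_shannon_entropy R T _ id cproj).
pose A := [set p : T | bernoulli_vectors K q p /\
  c <= shannon_entropy p + \sum_j q j * ln (q j)].
have cA : compact A.
  have cbox := @tychonoff _ (fun _ : 'I_N * 'I_K => R) (fun _ => `[0, 1]%classic)
    (fun _ => @segment_compact R 0 1).
  apply: (subclosed_compact _ cbox); last first.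
    move=> p [[[p0 p1] _] _] x; rewrite /= in_itv /= p0 /= -p1.
    by rewrite (bigD1 x)//= lerDl; apply: sumr_ge0.
  have -> : A = (\bigcap_(x in [set: 'I_N * 'I_K]) [set p : T | 0 <= p x]) `&`
     [set p : T | \sum_x p x = 1] `&`
     (\bigcap_(j in [set: 'I_N]) [set p : T | \sum_i p (j, i) = q j]) `&`
     [set p : T | c - \sum_j q j * ln (q j) <= shannon_entropy p].
    apply/seteqP; split=> p /=.
      move=> [[[p0 p1] pq] pe]; rewrite lerBlDr; split=> //.
      by split=> [|j _]; [split=> // x _; exact: p0|exact: pq].
    move=> [[[p0 p1] pq] pe]; split; last by rewrite -lerBlDr.
    by split=> [|j]; [split=> // x; exact: p0|exact: pq].
  have cl (g : T -> R) (D : set R) : continuous g -> closed D -> closed (g @^-1` D).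
    by move=> cg; apply: closed_comp => x _; exact: cg.
  apply: closedI; first apply: closedI; first apply: closedI.
  - apply: closed_bigI => x _; exact: (cl (fun p => p x) _ (cproj x) (@closed_ge R 0)).
  - apply: (cl (fun p => \sum_x p x) [set 1]); last exact: closed_eq.
    exact: (@continuous_sumr R T _ _ (fun x p => p x)).
  - apply: closed_bigI => j _; apply: (cl (fun p => \sum_i p (j, i)) [set q j]); last exact: closed_eq.
    exact: (@continuous_sumr R T _ _ (fun i p => p (j, i))).
  - exact: (cl _ _ cent (@closed_ge R _)).
(* The means of the vectors in the compact set [A] form a closed set, and the approximate solutions
   place [alpha] in its closure. *)
have : closed (mean @` A).
  apply: compact_closed; first exact: Rhausdorff.
  apply: continuous_compact => //.
  by apply: continuous_subspaceT => x; exact: cmean.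
move=> /(_ alpha)[].
  move=> B /nbhs_ballP[e /= e0 eB].
  have e2 : 0 < e / 2 by rewrite divr_gt0.
  have [p [pB pm pc]] := near_mean_gibbs_vector hK hq e2 Hc.
  exists (mean p); split; first by exists p.
  apply: eB; rewrite /ball /= distrC (le_lt_trans pm)// gtr_pMr// invf_lt1//.
  by rewrite ltr1n.
by move=> p [pB pc] <-; exists p; split.
Qed.

(** * Upper bound *)

(** Grouping indices by symbol turns the average into a combination of frequencies. These count
    [n + 1] indices, so the bounded last term, divided by [n], is subtracted and tends to 0. *)
Lemma frequency_average {R : realType} (N : nat) (q : 'I_N -> R)
    (w : nat -> 'I_N) (phi : 'I_N -> R) :
  frequency_regular q w ->
  (fun n : nat => n%:R^-1 * \sum_(k < n) phi (w k)) @ \oo -->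
  \sum_j q j * phi j.
Proof.
move=> hw.
have H : (fun n : nat => \sum_j (n%:R^-1 * #|[set k : 'I_n.+1 | w k == j]%SET|%:R) * phi j)
    @ \oo --> \sum_j q j * phi j.
  by apply: cvg_sumr => j; apply: cvgMr_tmp; exact: hw.
have H0 : (fun n : nat => n%:R^-1 * phi (w n)) @ \oo --> (0 : R).
  pose b := \sum_j `|phi j|.
  have pb j : `|phi j| <= b by rewrite /b (bigD1 j)//= lerDl sumr_ge0.
  apply: (@squeeze_cvgr _ _ _ _ (fun n : nat => n%:R^-1 * - b) (fun n : nat => n%:R^-1 * b)).
  - apply: nearW => n; have := pb (w n); rewrite ler_norml => /andP[? ?].
    by rewrite !ler_wpM2l ?invr_ge0.
  - by rewrite -(mul0r (- b)); apply: cvgMr_tmp; exact: cvg_invn.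
  - by rewrite -(mul0r b); apply: cvgMr_tmp; exact: cvg_invn.
rewrite -[X in _ --> X]subr0.
rewrite (_ : (fun n => _) = (fun n : nat =>
    \sum_j (n%:R^-1 * #|[set k : 'I_n.+1 | w k == j]%SET|%:R) * phi j -
    n%:R^-1 * phi (w n))); first exact: cvgB H H0.
apply/funext => n.
have -> : \sum_j n%:R^-1 * #|[set k : 'I_n.+1 | w k == j]%SET|%:R * phi j =
    n%:R^-1 * \sum_(k < n.+1) phi (w k).
  under eq_bigr do rewrite -mulrA.
  rewrite -mulr_sumr; congr (_ * _).
  under eq_bigr => j _.
    rewrite -sum1_card natr_sum mulr_suml big_mkcond /=.
    under eq_bigr do rewrite inE mul1r.
    over.
  rewrite exchange_big /=; apply: eq_bigr => k _.
  by rewrite -big_mkcond /= (eq_bigl (pred1 (w k))) ?big_pred1_eq// => j; rewrite eq_sym.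
by rewrite big_ord_recr /=; ring.
Qed.

Lemma entropy_premeasure_nondecreasing {R : realType} (K : nat) (s : R)
    (E : set (nat -> 'I_K)) :
  {homo entropy_premeasure s ^~ E : n m / (n <= m)%N >-> (n <= m)%E}.
Proof.
move=> n m nm; apply: le_ereal_inf => _ [C [Cm EC] <-].
by exists C => //; split=> // u /Cm; exact: leq_ltn_trans.
Qed.

(** Each partition function dominates its single term at [x k]; average the logarithms and pass to
    the limit. This makes exponents just above the pressure admissible in [htop], whose infimum runs
    over [0 <= s]. *)
Lemma pressure_ge {R : realType} (N K : nat) (hK : (0 < K)%N) (q : 'I_N -> R)
    (w : nat -> 'I_N) (f : 'I_N -> 'I_K -> R) (alpha t : R) (x : nat -> 'I_K) :
  frequency_regular q w -> level_set w f alpha x ->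
  0 <= pressure q (fun j i => t * f j i) - t * alpha.
Proof.
move=> hw Ex; rewrite subr_ge0.
have H1 := frequency_average (phi := fun j => ln (partition_function (fun i => t * f j i))) hw.
have H2 : (fun n : nat => t * (n%:R^-1 * \sum_(k < n) f (w k) (x k))) @ \oo --> t * alpha.
  by apply: cvgMl_tmp; exact: Ex.
apply: (ler_cvg_to H2 H1); apply: nearW => n /=.
rewrite mulrCA ler_wpM2l ?invr_ge0// mulr_sumr; apply: ler_sum => k _.
rewrite -[leLHS]expRK ler_ln ?posrE ?expR_gt0 ?partition_function_gt0//.
rewrite /partition_function (bigD1 (x k))//= lerDl.
by apply: sumr_ge0 => i _; exact: expR_ge0.
Qed.

Lemma sum_geometric_le {R : realType} (z : R) n :
  0 <= z < 1 -> \sum_(m < n) z ^+ m <= (1 - z)^-1.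
Proof.
move=> /andP[z0 z1]; have z1' : 0 < 1 - z by rewrite subr_gt0.
rewrite -[leRHS]mul1r ler_pdivlMr// mulrC -opprB mulNr -subrX1 opprB.
by rewrite gerBl exprn_ge0.
Qed.

(* Markov's inequality for the exponential of t times the Birkhoff sum. *)
Lemma sum_level_words_le {R : realType} (K n : nat) (hK : (0 < K)%N)
    (g : nat -> 'I_K -> R) (alpha t e s : R) (p : pred (seq 'I_K)) :
  (forall u, size u = n -> p u -> `|birkhoff g u - n%:R * alpha| <= n%:R * e) ->
  \sum_(u <- words K n | p u) expR (- (s * (size u)%:R)) <=
  expR (\sum_(k < n) ln (partition_function (fun i => t * g k i)) -
        n%:R * (t * alpha) + n%:R * (`|t| * e) - n%:R * s).
Proof.
move=> pe; have Z0 k := partition_function_gt0 (fun i => t * g k i) hK.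
pose d := - (n%:R * (t * alpha)) + n%:R * (`|t| * e) - n%:R * s.
have -> : expR (\sum_(k < n) ln (partition_function (fun i => t * g k i)) -
    n%:R * (t * alpha) + n%:R * (`|t| * e) - n%:R * s) =
    \sum_(u <- words K n) expR (t * birkhoff g u) * expR d.
  rewrite -mulr_suml (eq_bigr (weight (fun k i => expR (t * g k i)))); last first.
    by move=> u _; rewrite -birkhoffZ -weight_expR.
  rewrite sum_weight -!addrA expRD expR_sum /d -!addrA; congr (_ * _).
  by apply: eq_bigr => k _; rewrite lnK ?posrE.
rewrite big_mkcond big_seq [leRHS]big_seq; apply: ler_sum => u.
rewrite mem_words => /eqP su; case: ifP => pu; last by rewrite mulr_ge0 ?expR_ge0.
rewrite -expRD ler_expR su /d.
have : - (`|t| * (n%:R * e)) <= t * (birkhoff g u - n%:R * alpha).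
  rewrite lerNl (le_trans (ler_norm _))// normrN normrM ler_wpM2l//.
  exact: pe.
lra.
Qed.

(** The excess [d] is split in three: one third absorbs the error of the averaged log partition
    functions, one third the width [e] of the window, and the last makes the sum over lengths
    geometric, with a bound independent of [r]. *)
Lemma entropy_measure_lty {R : realType} (N K : nat) (hK : (0 < K)%N)
    (q : 'I_N -> R) (w : nat -> 'I_N) (f : 'I_N -> 'I_K -> R) (alpha t d : R) :
  frequency_regular q w -> 0 < d ->
  (entropy_measure (pressure q (fun j i => t * f j i) - t * alpha + d)%R
     (level_set w f alpha) < +oo)%E.
Proof.
move=> hw d0; set P := pressure _ _; set s := P - _ + d.
pose Z j := partition_function (fun i => t * f j i).
have d3 : 0 < d / 3 by rewrite divr_gt0.
pose e := d / 3 / (`|t| + 1).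
have t1 : 0 < `|t| + 1 by rewrite ltr_wpDl.
have e0 : 0 < e by rewrite divr_gt0.
have te : `|t| * e <= d / 3.
  by rewrite /e mulrCA ler_piMr ?(ltW d3)// ler_pdivrMr// mul1r lerDl.
have /cvgrPdist_le/(_ _ d3)[n0 _ Hn0] := frequency_average (phi := fun j => ln (Z j)) hw.
pose z := expR (- (d / 3)).
have z01 : 0 <= z < 1 by rewrite expR_ge0 expR_lt1 oppr_lt0.
suff Hr r : (entropy_premeasure s r (level_set w f alpha) <= ((1 - z)^-1)%:E)%E.
  apply: (@le_lt_trans _ _ ((1 - z)^-1)%:E); last exact: ltry.
  apply: lime_le; last by apply: nearW.
  exact: ereal_nondecreasing_is_cvgn (entropy_premeasure_nondecreasing _ _).
pose g k := f (w k).
(* Length above [r] makes this an admissible cover; length above [n0] puts the averages within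
   [d / 3] of their limit. *)
pose C := [set u : seq 'I_K | (maxn r n0 < size u)%N /\
  `|birkhoff g u - (size u)%:R * alpha| <= (size u)%:R * e].
apply: ereal_inf_le; exists (\esum_(u in C) (expR (- (s * (size u)%:R)))%:E)%E.
  exists C => //; split=> [u [+ _]|x Ex]; first by rewrite gtn_max => /andP[].
  have /cvgrPdist_le/(_ _ e0)[n1 _ Hn1] := Ex.
  pose n := (maxn (maxn r n0) n1).+1; exists (mkseq x n); last by rewrite /cylinder size_mkseq.
  split; rewrite size_mkseq; first by rewrite ltnS leq_maxl.
  have n_gt0 : (0 : R) < n%:R by rewrite ltr0n.
  rewrite birkhoff_mkseq -ler_pdivrMl// -(@ger0_norm _ n%:R^-1) ?invr_ge0 ?ler0n//.
  rewrite -normrM mulrBr mulKf ?gt_eqF// distrC; apply: Hn1 => /=.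
  by rewrite /n leqW// leq_maxr.
apply: esum_words_le => [u|n]; first exact: expR_ge0.
apply: le_trans (sum_geometric_le n z01); apply: ler_sum => m _.
have [mr|rm] := leqP m (maxn r n0).
  rewrite big1_seq ?exprn_ge0 ?expR_ge0// => u /andP[/asboolP[ru _]].
  by rewrite mem_words => /eqP su; move: ru; rewrite su ltnNge mr.
have H u : size u = m -> `[< C u >] -> `|birkhoff g u - m%:R * alpha| <= m%:R * e.
  by move=> <- /asboolP[].
apply: (le_trans (sum_level_words_le hK t s H)).
rewrite /z -expRM_natl ler_expR.
have m0 : (0 : R) < m%:R by rewrite ltr0n (leq_ltn_trans _ rm).
have /Hn0 : (n0 <= m)%N by rewrite (leq_trans _ (ltnW rm))// leq_maxr.
rewrite /= -/(pressure q (fun j i => t * f j i)) ler_norml => /andP[+ _].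
rewrite lerNl opprB lerBlDr ler_pdivrMl// -/P => H1.
have : m%:R * (`|t| * e) <= m%:R * (d / 3) by rewrite ler_pM2l.
by rewrite /s; move: H1; rewrite /Z /g; nra.
Qed.

Lemma htop_le_pressure {R : realType} (N K : nat) (hK : (0 < K)%N)
    (q : 'I_N -> R) (w : nat -> 'I_N) (f : 'I_N -> 'I_K -> R) (alpha t : R) :
  frequency_regular q w ->
  (htop R (level_set w f alpha) <=
   (pressure q (fun j i => t * f j i) - t * alpha)%:E)%E.
Proof.
move=> hw; rewrite /htop; case: asboolP => [_|/eqP/set0P[x Ex]]; first exact: leNye.
have P0 := pressure_ge hK t hw Ex.
apply/lee_addgt0Pr => d d0; apply: ereal_inf_lbound.
eexists; last by rewrite -EFinD.
split; first by rewrite addr_ge0// ltW.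
exact: entropy_measure_lty.
Qed.

(** * Lower bound *)

Lemma expR_le_quadratic {R : realType} (y : R) :
  2 * y <= 1 -> expR y <= 1 + y + 2 * y ^+ 2.
Proof.
move=> y2; have y1 : 0 < 1 - y by lra.
have H := @expR_ge1Dx R (- y).
have H2 : expR y * (1 - y) <= 1.
  by apply: le_trans (ler_wpM2l (expR_ge0 y) H) _; rewrite expRxMexpNx_1.
rewrite -(ler_pM2r y1) (le_trans H2)//.
(* [(1 - y) * (1 + y + 2 * y ^+ 2)] equals 1 plus this quantity. *)
have : 0 <= y ^+ 2 * (1 - 2 * y) by rewrite mulr_ge0 ?sqr_ge0 ?subr_ge0.
nra.
Qed.

(** In the quadratic bound for the exponential the linear term has mean zero after centering, and
    [|h i - m| <= 2 * c] turns the quadratic term into the constant 8. *)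
Lemma centered_mgf_le {R : realType} (K : nat) (P h : 'I_K -> R) (c theta : R) :
  (forall i, 0 <= P i) -> \sum_i P i = 1 -> (forall i, `|h i| <= c) ->
  4 * (`|theta| * c) <= 1 ->
  \sum_i P i * expR (theta * (h i - \sum_j P j * h j)) <=
  expR (8 * (theta ^+ 2 * c ^+ 2)).
Proof.
move=> P0 P1 hc tc; set m := \sum_j P j * h j.
have mc : `|m| <= c.
  rewrite (le_trans (ler_norm_sum _ _ _))// -[leRHS]mul1r -P1 mulr_suml.
  by apply: ler_sum => i _; rewrite normrM ger0_norm ?ler_wpM2l.
have dc i : `|h i - m| <= 2 * c.
  by rewrite (le_trans (ler_normB _ _))// mulr2n mulrDl mul1r lerD.
have ti i : expR (theta * (h i - m)) <=
    1 + theta * (h i - m) + 8 * (theta ^+ 2 * c ^+ 2).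
  apply: (le_trans (expR_le_quadratic _)).
    have : theta * (h i - m) <= `|theta| * (2 * c).
      by rewrite (le_trans (ler_norm _))// normrM ler_wpM2l.
    lra.
  rewrite lerD2l exprMn.
  have : (h i - m) ^+ 2 <= (2 * c) ^+ 2.
    by rewrite -real_normK ?num_real// ler_pXn2r ?nnegrE// (le_trans _ (dc i)).
  move=> /(ler_wpM2l (sqr_ge0 theta)); lra.
have mE : \sum_j P j * h j = m by [].
clearbody m; apply: (@le_trans _ _ (\sum_i P i * (1 + theta * (h i - m) + 8 * (theta ^+ 2 * c ^+ 2)))).
  by apply: ler_sum => i _; rewrite ler_wpM2l.
have -> : \sum_i P i * (1 + theta * (h i - m) + 8 * (theta ^+ 2 * c ^+ 2)) =
    (1 + 8 * (theta ^+ 2 * c ^+ 2) - theta * m) * (\sum_i P i) + theta * \sum_i P i * h i.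
  rewrite !mulr_sumr -big_split /=.
  by apply: eq_bigr => i _; ring.
by rewrite P1 mE mulr1 subrK; exact: expR_ge1Dx.
Qed.

Lemma weight_mgf_le {R : realType} (K n : nat) (P g : nat -> 'I_K -> R) (c theta : R) :
  (forall k i, 0 <= P k i) -> (forall k, \sum_i P k i = 1) ->
  (forall k i, `|g k i| <= c) -> 4 * (`|theta| * c) <= 1 ->
  \sum_(u <- words K n) weight P u *
     expR (theta * (birkhoff g u - \sum_(k < n) \sum_i P k i * g k i)) <=
  expR (n%:R * (8 * (theta ^+ 2 * c ^+ 2))).
Proof.
move=> P0 P1 gc tc; pose m k := \sum_i P k i * g k i.
have -> : \sum_(u <- words K n) weight P u *
    expR (theta * (birkhoff g u - \sum_(k < n) \sum_i P k i * g k i)) =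
    \sum_(u <- words K n) weight (fun k i => P k i * expR (theta * (g k i - m k))) u.
  rewrite big_seq [RHS]big_seq; apply: eq_bigr => u; rewrite mem_words => /eqP su.
  by rewrite weightM weight_expR birkhoffZ birkhoffB su.
have <- : \prod_(k < n) expR (8 * (theta ^+ 2 * c ^+ 2)) =
    expR (n%:R * (8 * (theta ^+ 2 * c ^+ 2))).
  by rewrite prodr_const card_ord (expRM_natl n).
rewrite sum_weight.
apply: ler_prod => k _; rewrite centered_mgf_le// andbT.
by apply: sumr_ge0 => i _; rewrite mulr_ge0 ?expR_ge0.
Qed.

Definition deviates {R : realType} {K : nat} (P g : nat -> 'I_K -> R) (e : R)
    (u : seq 'I_K) : bool :=
  (size u)%:R * e <
  `|birkhoff g u - \sum_(k < size u) \sum_i P k i * g k i|.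

Lemma chernoff_bound {R : realType} (K n : nat) (P g : nat -> 'I_K -> R) (c e : R) :
  (forall k i, 0 <= P k i) -> (forall k, \sum_i P k i = 1) ->
  (forall k i, `|g k i| <= c) -> 0 < c -> 0 <= e <= 4 * c ->
  \sum_(u <- words K n | deviates P g e u) weight P u <=
  2 * expR (- (n%:R * e ^+ 2 / (32 * c ^+ 2))).
Proof.
move=> P0 P1 gc c0 /andP[e0 ec].
(* The minimizer of [- theta * e + 8 * theta ^+ 2 * c ^+ 2]; [e <= 4 * c] keeps it in the range of
   the moment bound. Using both [theta] and [- theta] covers the two signs and costs the factor
   2. *)
pose theta := e / (16 * c ^+ 2).
have c20 : 0 < 16 * c ^+ 2 by rewrite mulr_gt0 ?exprn_gt0.
have th0 : 0 <= theta by rewrite divr_ge0// ltW.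
have thc : 4 * (`|theta| * c) <= 1.
  rewrite ger0_norm// /theta mulrAC mulrA ler_pdivrMr//.
  by move: ec; rewrite -(ler_pM2r c0); nra.
pose y u := birkhoff g u - \sum_(k < n) \sum_i P k i * g k i.
have H1 := weight_mgf_le n P0 P1 gc thc.
have H2 : \sum_(u <- words K n) weight P u * expR (- theta * y u) <=
    expR (n%:R * (8 * (theta ^+ 2 * c ^+ 2))).
  by rewrite -(sqrrN theta); apply: weight_mgf_le => //; rewrite normrN.
have := lerD H1 H2; rewrite -/y -big_split /=.
move=> /(ler_wpM2l (expR_ge0 (- (theta * (n%:R * e))))).
rewrite -mulr2n -[_ *+ 2]mulr_natl [leRHS]mulrCA -expRD.
have -> : - (theta * (n%:R * e)) + n%:R * (8 * (theta ^+ 2 * c ^+ 2)) =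
    - (n%:R * e ^+ 2 / (32 * c ^+ 2)).
  by rewrite /theta; field; rewrite gt_eqF.
apply: le_trans; rewrite mulr_sumr big_mkcond big_seq [leRHS]big_seq.
apply: ler_sum => u; rewrite mem_words /deviates => /eqP su; rewrite su -/(y u).
have w0 := weight_ge0 u P0; case: ifP => [|_]; last first.
  by rewrite mulr_ge0 ?expR_ge0 ?addr_ge0 ?mulr_ge0 ?expR_ge0.
move=> /ltW ney; rewrite -mulrDr mulrCA ler_peMr// mulrDr -!expRD.
have : 1 <= expR (theta * (`|y u| - n%:R * e)).
  by rewrite (le_trans _ (expR_ge1Dx _))// lerDl mulr_ge0// subr_ge0.
move=> /le_trans; apply; have [yu|yu] := leP 0 (y u).
  by rewrite ger0_norm// ler_wpDr ?expR_ge0// ler_expR; lra.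
by rewrite ltr0_norm// ler_wpDl ?expR_ge0// ler_expR; lra.
Qed.

(* n^(-1/4): it tends to 0, while n * deviation_rate n ^+ 2 = sqrt n makes the
   Chernoff bound summable. *)
Definition deviation_rate {R : realType} (n : nat) : R :=
  Num.sqrt (Num.sqrt n%:R^-1).

Lemma cvg_deviation_rate {R : realType} : @deviation_rate R @ \oo --> (0 : R).
Proof.
have sqrt_cvg (u : nat -> R) : u @ \oo --> (0 : R) -> Num.sqrt (u n) @[n --> \oo] --> (0 : R).
  move=> u0; rewrite -[X in _ --> X](@sqrtr0 R).
  by apply: (cvg_comp _ _ u0); exact: sqrt_continuous.
exact: (sqrt_cvg _ (sqrt_cvg _ cvg_invn)).
Qed.

(* exp (- x) is bounded by 24 / x ^+ 4, with x proportional to sqrt n. *)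
Lemma deviation_bound {R : realType} (K : nat) (P g : nat -> 'I_K -> R) (c : R) :
  (forall k i, 0 <= P k i) -> (forall k, \sum_i P k i = 1) ->
  (forall k i, `|g k i| <= c) ->
  exists2 A : R, 0 <= A & forall n, (0 < n)%N ->
    \sum_(u <- words K n | deviates P g (deviation_rate n) u) weight P u <=
    A * n%:R ^- 2.
Proof.
(* A bound at least 1 dominates the deviation rate, as [chernoff_bound] requires. *)
move=> P0 P1 gc; pose b := `|c| + 1.
have b1 : 1 <= b by rewrite lerDr.
have b0 : 0 < b by exact: lt_le_trans b1.
have gb k i : `|g k i| <= b.
  by rewrite (le_trans (gc k i))// (le_trans (ler_norm c))// lerDl.
exists (48 * (32 * b ^+ 2) ^+ 4) => [|n n0]; first by rewrite mulr_ge0 ?exprn_ge0 ?mulr_ge0 ?ltW.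
have n1 : (1 : R) <= n%:R by rewrite ler1n.
have nR0 : (0 : R) < n%:R by rewrite ltr0n.
have rate : 0 <= (deviation_rate n : R) <= 4 * b.
  rewrite /deviation_rate sqrtr_ge0 (@le_trans _ _ 1) ?mulr_ege1 ?ler1n//.
  by rewrite -[leRHS]sqrtr1 ler_wsqrtr// -[leRHS]sqrtr1 ler_wsqrtr// invf_le1.
apply: (le_trans (chernoff_bound n P0 P1 gb b0 rate)).
set x := n%:R * _ / _.
have x4 : x ^+ 4 = n%:R ^+ 2 / (32 * b ^+ 2) ^+ 4.
  rewrite /x /deviation_rate expr_div_n exprMn sqr_sqrtr ?sqrtr_ge0//; congr (_ / _).
  rewrite (_ : Num.sqrt n%:R^-1 ^+ 4 = (Num.sqrt n%:R^-1 ^+ 2) ^+ 2); last by rewrite -exprM.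
  by rewrite sqr_sqrtr ?invr_ge0//; field; rewrite gt_eqF.
have x0 : 0 < x by rewrite /x !(divr_gt0, mulr_gt0, exprn_gt0, sqrtr_gt0, invr_gt0).
have := expR_ge1Dxn 3 (ltW x0); rewrite x4 => H.
have H2 : n%:R ^+ 2 / (32 * b ^+ 2) ^+ 4 / 24 <= expR x.
  by apply: le_trans H; rewrite lerDr.
have q0 : 0 < n%:R ^+ 2 / (32 * b ^+ 2) ^+ 4 / 24.
  by rewrite -x4 divr_gt0 ?exprn_gt0.
rewrite expRN; move: H2; rewrite -(lef_pV2 _ _) ?posrE ?expR_gt0// => H2.
apply: (@le_trans _ _ (2 * (n%:R ^+ 2 / (32 * b ^+ 2) ^+ 4 / 24)^-1)).
  by rewrite ler_pM2l.
by rewrite le_eqVlt; apply/orP; left; apply/eqP; field; rewrite !gt_eqF.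
Qed.

(** Telescoping, from [(n + 1) ^- 2 <= n^-1 - (n + 1)^-1]; the induction carries the remaining tail
    [(maxn n n0)^-1]. *)
Lemma sum_inv_sqr_le {R : realType} (n0 n : nat) : (0 < n0)%N ->
  \sum_(m < n | (n0 < m)%N) (m%:R ^- 2 : R) <= n0%:R^-1.
Proof.
move=> n00.
suff : \sum_(m < n.+1 | (n0 < m)%N) (m%:R ^- 2 : R) + (maxn n n0)%:R^-1 <= n0%:R^-1.
  apply: le_trans; rewrite big_mkcond [in leRHS]big_mkcond big_ord_recr /=.
  rewrite -addrA lerDl addr_ge0 ?invr_ge0//.
  by case: ifP => // _; rewrite invr_ge0 exprn_ge0.
elim: n => [|n IH].
  by rewrite big_mkcond big_ord_recr big_ord0 /= add0r max0n add0r.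
apply: le_trans IH; rewrite big_mkcond big_ord_recr -big_mkcond /= -addrA lerD2l.
case: ltnP => [|nn]; last by rewrite add0r (maxn_idPr (ltnW nn)).
rewrite ltnS => nn; rewrite (maxn_idPl nn).
have n0' : (0 : R) < n%:R by rewrite ltr0n (leq_trans n00).
rewrite -natr1 -subr_ge0.
have -> : n%:R^-1 - ((n%:R + 1) ^- 2 + (n%:R + 1)^-1) =
    (n%:R * (n%:R + 1) ^+ 2)^-1 :> R.
  by field; rewrite !gt_eqF// ltr_wpDl// ltW.
by rewrite invr_ge0 mulr_ge0// sqr_ge0.
Qed.

(* Symbols j with q j = 0 have density 0 in w, so that any distribution serves
   for them. *)
Definition conditional {R : realType} {N K : nat} (q : 'I_N -> R)
    (p : 'I_N * 'I_K -> R) (j : 'I_N) (i : 'I_K) : R :=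
  if q j == 0 then K%:R^-1 else p (j, i) / q j.

Lemma conditional_ge0 {R : realType} (N K : nat) (q : 'I_N -> R)
    (p : 'I_N * 'I_K -> R) j i :
  probability_vector q -> bernoulli_vectors K q p -> 0 <= conditional q p j i.
Proof.
move=> [q0 _] [[p0 _] _]; rewrite /conditional; case: ifP => _.
  by rewrite invr_ge0.
by rewrite divr_ge0.
Qed.

Lemma sum_conditional {R : realType} (N K : nat) (hK : (0 < K)%N) (q : 'I_N -> R)
    (p : 'I_N * 'I_K -> R) j :
  bernoulli_vectors K q p -> \sum_i conditional q p j i = 1.
Proof.
move=> [_ pq]; rewrite /conditional; case: eqP => [_|/eqP qj].
  by rewrite sumr_const card_ord -[LHS]mulr_natl divff// pnatr_eq0 -lt0n.
by rewrite -mulr_suml pq divff.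
Qed.

Lemma bernoulli_vector_eq0 {R : realType} (N K : nat) (q : 'I_N -> R)
    (p : 'I_N * 'I_K -> R) j i :
  bernoulli_vectors K q p -> q j = 0 -> p (j, i) = 0.
Proof.
move=> [[p0 _] pq] qj.
by apply: (@psumr_eq0P _ _ xpredT (fun i => p (j, i))); rewrite ?pq.
Qed.

Lemma conditionalE {R : realType} (N K : nat) (q : 'I_N -> R)
    (p : 'I_N * 'I_K -> R) j i :
  bernoulli_vectors K q p -> q j * conditional q p j i = p (j, i).
Proof.
move=> hp; rewrite /conditional; case: eqP => [qj|/eqP qj].
  by rewrite (bernoulli_vector_eq0 i hp qj) qj mul0r.
by rewrite mulrC divfK.
Qed.

(** The chain rule: the entropy of [p] is that of [q] plus the average entropy of the conditional
    laws. *)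
Lemma conditional_entropy {R : realType} (N K : nat) (hK : (0 < K)%N)
    (q : 'I_N -> R) (p : 'I_N * 'I_K -> R) :
  probability_vector q -> bernoulli_vectors K q p ->
  \sum_j q j * \sum_i conditional q p j i * - ln (conditional q p j i) =
  shannon_entropy p + \sum_j q j * ln (q j).
Proof.
move=> hq hp; have [q0 _] := hq; have [[p0 _] pq] := hp.
rewrite shannon_entropy_pair -sumrN -big_split /=; apply: eq_bigr => j _.
rewrite -{2}(pq j) mulr_suml mulr_sumr -sumrN -big_split /=.
apply: eq_bigr => i _; rewrite mulrA conditionalE// /conditional.
case: eqP => [qj|/eqP qj].
  by rewrite (bernoulli_vector_eq0 i hp qj) !mul0r oppr0 addr0.
have := p0 (j, i); rewrite le0r => /predU1P[->|pi]; first by rewrite !mul0r oppr0 addr0.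
by rewrite ln_div ?posrE// ?lt_neqAle ?q0 ?andbT 1?eq_sym//; ring.
Qed.

(** * Covers of the level set *)

Lemma cover_sum_ge {R : realType} (N K : nat) (hK : (0 < K)%N)
    (q : 'I_N -> R) (w : nat -> 'I_N) (f : 'I_N -> 'I_K -> R)
    (p : 'I_N * 'I_K -> R) (s : R) :
  probability_vector q -> frequency_regular q w -> bernoulli_vectors K q p ->
  s < shannon_entropy p + \sum_j q j * ln (q j) ->
  exists r0, forall r C, (r0 <= r)%N ->
    cylinder_cover (level_set w f (\sum_j \sum_i p (j, i) * f j i)) r C ->
    exists n, 2^-1 <=
      \sum_(m < n) \sum_(u <- words K m | `[< C u >]) expR (- (s * (size u)%:R)).
Proof.
move=> hq hw hp; rewrite -conditional_entropy//.
pose mu j i := conditional q p j i.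
pose info j i := - ln (mu j i).
rewrite -/mu => sh.
pose P k := mu (w k); pose g1 k := f (w k); pose g2 k := info (w k).
have P0 k i : 0 <= P k i by exact: conditional_ge0.
have P1 k : \sum_i P k i = 1 by exact: sum_conditional.
have bounded (phi : 'I_N -> 'I_K -> R) k i :
    `|phi (w k) i| <= \sum_j \sum_i `|phi j i|.
  rewrite (bigD1 (w k))//= (bigD1 i)//= -addrA lerDl addr_ge0//.
    by apply: sumr_ge0.
  by apply: sumr_ge0 => ? _; apply: sumr_ge0.
have [A1 A10 HA1] := deviation_bound P0 P1 (bounded f).
have [A2 A20 HA2] := deviation_bound P0 P1 (bounded info).
pose bad u := deviates P g1 (deviation_rate (size u)) u ||
              deviates P g2 (deviation_rate (size u)) u.
have cf := frequency_average (phi := fun j => \sum_i mu j i * f j i) hw.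
have ci := frequency_average (phi := fun j => \sum_i mu j i * info j i) hw.
have mean_f : \sum_j q j * \sum_i mu j i * f j i = \sum_j \sum_i p (j, i) * f j i.
  apply: eq_bigr => j _; rewrite mulr_sumr; apply: eq_bigr => i _.
  by rewrite mulrA conditionalE.
rewrite mean_f in cf.
(* Beyond [n1], a word whose information is within the deviation rate of its mean has information at
   least [s] per letter. *)
have [n1 _ Hn1] : \forall n \near \oo, s <=
    n%:R^-1 * \sum_(k < n) \sum_i mu (w k) i * info (w k) i - deviation_rate n.
  have c0 : (fun n : nat => n%:R^-1 * \sum_(k < n) \sum_i mu (w k) i * info (w k) i -
      deviation_rate n) @ \oo --> \sum_j q j * \sum_i mu j i * info j i.
    by rewrite -[X in _ --> X]subr0; exact: cvgB ci (@cvg_deviation_rate R).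
  exact: (cvgr_ge _ c0 _ sh).
(* Large enough that the bad words longer than [n0] have total weight at most 1/2. *)
pose n0 := (Num.truncn (2 * (A1 + A2))).+1.
have n0P : (A1 + A2) * n0%:R^-1 <= 2^-1.
  rewrite ler_pdivrMr ?ltr0n// mulrC ler_pdivlMr// mulrC ltW//.
  exact: real_truncnS_gt (num_real _).
exists (maxn n0 n1) => r C; rewrite geq_max => /andP[n0r n1r] [Cr EC].
(* A point with no bad prefix beyond n0 lies in the level set, hence in C. *)
pose D := [set u | (C u /\ ~~ bad u) \/ ((n0 < size u)%N /\ bad u)].
have [x|n Hn] := @prefix_weight_ge1 R K P D P0 P1.
  have [[n [nn0 nb]]|/forallNP nb] := pselect (exists n, (n0 < n)%N /\ bad (mkseq x n)).
    by exists n; right; rewrite size_mkseq.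
  have /EC[u Cu xu] : level_set w f (\sum_j \sum_i p (j, i) * f j i) x.
    rewrite /level_set /=.
    have dev : (fun n : nat => n%:R^-1 * \sum_(k < n) f (w k) (x k) -
        n%:R^-1 * \sum_(k < n) \sum_i mu (w k) i * f (w k) i) @ \oo --> (0 : R).
      apply: (@squeeze_cvgr _ _ _ _ (fun n => - deviation_rate n) deviation_rate); last exact: cvg_deviation_rate.
        exists n0.+1 => // n /= nn0; have n_gt0 : (0 : R) < n%:R by rewrite ltr0n (leq_trans _ nn0).
        have /negP := fun b => nb n (conj nn0 b).
        rewrite /bad negb_or => /andP[+ _]; rewrite /deviates size_mkseq -leNgt.
        rewrite birkhoff_mkseq -mulrBr -ler_norml normrM ger0_norm ?invr_ge0 ?ler0n//.
        by rewrite ler_pdivrMl.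
      by rewrite -oppr0; apply: cvgN; exact: cvg_deviation_rate.
    rewrite -[X in _ --> X]add0r.
    rewrite (_ : (fun n => _) = (fun n : nat => (n%:R^-1 * \sum_(k < n) f (w k) (x k) -
        n%:R^-1 * \sum_(k < n) \sum_i mu (w k) i * f (w k) i) +
        n%:R^-1 * \sum_(k < n) \sum_i mu (w k) i * f (w k) i)); first exact: cvgD dev cf.
    by apply/funext => n; rewrite subrK.
  exists (size u); rewrite xu; left; split=> //.
  apply/negP => bu; apply: (nb (size u)); rewrite xu; split=> //.
  by rewrite (leq_trans _ (Cr u Cu))// ltnS.
exists n.
pose bad_sum m := \sum_(u <- words K m | deviates P g1 (deviation_rate m) u) weight P u
  + \sum_(u <- words K m | deviates P g2 (deviation_rate m) u) weight P u.
have bad_le : \sum_(m < n | (n0 < m)%N) bad_sum m <= 2^-1.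
  apply: le_trans n0P.
  apply: (@le_trans _ _ (\sum_(m < n | (n0 < m)%N) (A1 + A2) * m%:R ^- 2)).
    apply: ler_sum => m n0m; have m0 : (0 < m)%N by exact: leq_ltn_trans n0m.
    by rewrite mulrDl lerD ?HA1 ?HA2.
  rewrite -mulr_sumr ler_wpM2l ?addr_ge0//; exact: sum_inv_sqr_le.
suff : \sum_(m < n) \sum_(u <- words K m | `[< D u >]) weight P u <=
    \sum_(m < n) \sum_(u <- words K m | `[< C u >]) expR (- (s * (size u)%:R)) +
    \sum_(m < n | (n0 < m)%N) bad_sum m by move: Hn bad_le; lra.
rewrite [X in _ <= _ + X]big_mkcond -big_split; apply: ler_sum => m _ /=.
have good u : C u -> ~~ bad u -> weight P u <= expR (- (s * (size u)%:R)).
  move=> Cu; rewrite /bad negb_or => /andP[_]; rewrite /deviates -leNgt => gu.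
  have ru := Cr u Cu; have u0 : (0 : R) < (size u)%:R by rewrite ltr0n (leq_ltn_trans _ ru).
  have su := Hn1 (size u) (ltnW (leq_ltn_trans n1r ru)).
  apply: (@le_trans _ _ (expR (- birkhoff g2 u))).
    (* Only an inequality: ln 0 = 0, so letters of probability 0 have information 0. *)
    rewrite -mulN1r -birkhoffZ -weight_expR; apply: ler_prod => -[k i] _ /=.
    rewrite P0 /= mulN1r opprK.
    have := P0 k i; rewrite le0r => /predU1P[->|Pk]; first exact: expR_ge0.
    by rewrite lnK ?posrE.
  rewrite ler_expR lerN2 mulrC; move: gu; rewrite ler_norml => /andP[gu _].
  have {}su : (size u)%:R * s <= \sum_(k < size u) \sum_i mu (w k) i * info (w k) i
      - (size u)%:R * deviation_rate (size u).
    rewrite -(ler_pM2l u0) in su; move: su.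
    by rewrite mulrBr mulrA divff ?mul1r// gt_eqF.
  move: gu su; rewrite /P /g2 => gu su; lra.
have w0 u := weight_ge0 u P0.
have bad0 : 0 <= (if (n0 < m)%N then bad_sum m else 0).
  by case: ifP => // _; rewrite addr_ge0 ?sumr_ge0.
(* Up to length [n0] the set [D] holds only good words of [C]; beyond it, each word is charged to
   [C] or to one of the two deviation sums. *)
have [n0m|mn0] := ltnP n0 m; last first.
  rewrite addr0 big_mkcond big_seq [leRHS]big_mkcond [leRHS]big_seq.
  apply: ler_sum => u; rewrite mem_words => /eqP su.
  case: asboolP => [[[Cu nb]|[+ _]]|_].
  - by rewrite asboolT// good.
  - by rewrite su ltnNge mn0.
  - by case: ifP => // _; exact: expR_ge0.
rewrite /bad_sum [leLHS]big_mkcond [X in _ <= X + _]big_mkcond.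
rewrite [X in _ <= _ + (X + _)]big_mkcond [X in _ <= _ + (_ + X)]big_mkcond.
rewrite -!big_split big_seq [leRHS]big_seq.
apply: ler_sum => u; rewrite mem_words => /eqP su /=.
have e0 := expR_ge0 (- (s * (size u)%:R)).
have d0 (b : bool) : 0 <= (if b then weight P u else 0) by case: b.
have c0 : 0 <= (if `[< C u >] then expR (- (s * (size u)%:R)) else 0) by case: ifP.
case: (asboolP (D u)) => [[[Cu nb]|[_ +]]|_]; last by rewrite !addr_ge0.
  by rewrite (asboolT Cu) (le_trans (good u Cu nb))// lerDl addr_ge0.
move: c0; rewrite /bad su => c0 /orP[] ->; first by rewrite /= addrCA lerDl addr_ge0.
by rewrite /= addrA lerDr addr_ge0.
Qed.

(** For [s < h], a cover by words longer than [r] has sum at least 1/2 already at some [s + d < h];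
    lowering the exponent to [s] gains the factor [expR (d * r)], so the measure at [s] is
    infinite. *)
Lemma htop_ge_entropy {R : realType} (N K : nat) (hK : (0 < K)%N)
    (q : 'I_N -> R) (w : nat -> 'I_N) (f : 'I_N -> 'I_K -> R)
    (p : 'I_N * 'I_K -> R) :
  probability_vector q -> frequency_regular q w -> bernoulli_vectors K q p ->
  ((shannon_entropy p + \sum_j q j * ln (q j))%R%:E <=
  htop R (level_set w f (\sum_j \sum_i p (j, i) * f j i)))%E.
Proof.
move=> hq hw hp; set h := shannon_entropy p + _; set E := level_set _ _ _.
have Hcover s : s < h -> exists r0, forall r C, (r0 <= r)%N -> cylinder_cover E r C ->
    exists n, 2^-1 <=
      \sum_(m < n) \sum_(u <- words K m | `[< C u >]) expR (- (s * (size u)%:R)).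
  by move=> sh; exact: (@cover_sum_ge R N K hK q w f p s hq hw hp sh).
rewrite /htop; case: asboolP => [E0|_].
  (* The level set is nonempty: otherwise the empty family would cover it with sum 0, below 1/2. *)
  have h1 : h - 1 < h by rewrite ltrBlDr ltrDl.
  have [r0 H] := Hcover _ h1.
  have [|n] := H r0 set0 (leqnn _).
    by split=> [u []|]; rewrite E0; exact: sub0set.
  rewrite big1; first by rewrite leNgt invr_gt0 ltr0n.
  by move=> m _; rewrite big_pred0// => u; apply/asboolP.
apply: le_ereal_inf_tmp => _ [s [_ Hs] <-]; rewrite lee_fin leNgt.
apply/negP => sh; pose d := (h - s) / 2.
have d0 : 0 < d by rewrite divr_gt0 ?subr_gt0.
have sdh : s + d < h by rewrite /d; lra.
have [r0 H] := Hcover _ sdh.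
have Hr r : (r0 <= r)%N -> ((2^-1 * (d * r%:R))%:E <= entropy_measure s E)%E.
  move=> rr; apply: (@le_trans _ _ (entropy_premeasure s r E)); last first.
    rewrite /entropy_measure.
    rewrite (cvg_lim _ (ereal_nondecreasing_cvgn (entropy_premeasure_nondecreasing s E)))//.
    by apply: ereal_sup_ubound; exists r.
  apply: le_ereal_inf_tmp => _ [C CE <-]; have [n Hn] := H r C rr CE.
  apply: le_trans (esum_words_ge n C _); rewrite lee_fin.
  apply: (@le_trans _ _ (2^-1 * expR (d * r%:R))).
    by rewrite ler_pM2l ?invr_gt0// (le_trans _ (expR_ge1Dx _))// lerDr.
  apply: (le_trans (ler_wpM2r (expR_ge0 _) Hn)).
  rewrite mulr_suml; apply: ler_sum => m _; rewrite mulr_suml.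
  apply: ler_sum => u /asboolP Cu; rewrite -expRD ler_expR.
  have [Cr _] := CE; have /ltnW ru := Cr u Cu.
  have : d * r%:R <= d * (size u)%:R by rewrite ler_pM2l// ler_nat.
  lra.
case: (entropy_measure s E) Hs Hr => [x _ Hr| // |_ Hr]; last first.
  by have := Hr r0 (leqnn _); rewrite leNgt ltNyr.
(* Large enough that the lower bound [2^-1 * (d * r)] exceeds the supposed finite value [x]. *)
pose r := maxn r0 (Num.truncn (`|x| * 2 / d)).+1.
have := Hr r (leq_maxl _ _); rewrite lee_fin leNgt => /negP; apply.
have : `|x| * 2 / d < r%:R.
  by rewrite (lt_le_trans (real_truncnS_gt (num_real _)))// ler_nat /r leq_maxr.
rewrite ltr_pdivrMr// => xr; apply: (le_lt_trans (ler_norm x)); lra.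
Qed.

Theorem theorem2p6 (R : realType) (N K : nat) (hK : (0 < K)%N)
    (q : 'I_N -> R) (w : nat -> 'I_N) (f : 'I_N -> 'I_K -> R)
    (hq : probability_vector q) (hw : frequency_regular q w) (alpha : R) :
  let entropy_sup : \bar R :=
    ereal_sup [set (shannon_entropy p)%:E
              | p in [set p : 'I_N * 'I_K -> R | bernoulli_vectors K q p /\
                  \sum_(j < N) \sum_(i < K) p (j, i) * f j i = alpha]] in
  let q_log_q : R := \sum_(j < N) q j * ln (q j) in
  htop R (level_set w f alpha) = (entropy_sup + q_log_q%:E)%E /\
  (entropy_sup + q_log_q%:E)%E =
    ereal_inf [set (pressure q (fun j i => p * f j i) - p * alpha)%:E
              | p in [set: R]].
Proof.
move=> S L; set I := ereal_inf _.
have Sh : (S + L%:E <= htop R (level_set w f alpha))%E.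
  rewrite -leeBrDr//; apply: ge_ereal_sup => _ [p [hp mp] <-].
  by rewrite leeBrDr// -EFinD -mp; exact: htop_ge_entropy.
have hI : (htop R (level_set w f alpha) <= I)%E.
  by apply: le_ereal_inf_tmp => _ [t _ <-]; exact: htop_le_pressure.
have IS : (I <= S + L%:E)%E.
  have It t : (I <= (pressure q (fun j i => t * f j i) - t * alpha)%:E)%E.
    by apply: ereal_inf_lbound; exists t.
  (* A finite infimum is realized by a vector; [+oo] is excluded by the finite pressure value at 0,
     and [-oo] is trivially below. *)
  case: I hI It => [c _ It|_ /(_ 0)//|_ _]; last exact: leNye.
  have [t|p [hp mp cp]] := @bernoulli_vector_of_pressure R N K hK q f alpha c hq.
    by have := It t; rewrite lee_fin.
  apply: (@le_trans _ _ ((shannon_entropy p)%:E + L%:E)%E); first by rewrite -EFinD lee_fin.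
  by rewrite leeD2r//; apply: ereal_sup_ubound; exists p.
split; apply/le_anti/andP; split=> //.
- exact: le_trans IS.
- exact: le_trans Sh hI.
Qed.
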